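(* The spaces $H^S_{p,q}(\mathbb{R})$ and $H^*_{p,q}(\mathbb{R})$ are equivalent for $1\le p<\infty$ and $1\le q\le\infty$. Namely, for every $1\le p<\infty$ there are constants $c_p,C_p>0$ depending only on $p$ such that for every martingale $f\in\mathcal{M}$ (inequalities being understood in $[0,\infty]$), $$c_{p}\|f\|_{H_{p,q}^S(\mathbb{R})}\le \|f\|_{H_{p,q}^*(\mathbb{R})}\le C_{p}\|f\|_{H_{p,q}^S(\mathbb{R})}\qquad (1\le q<\infty)$$ and $$c_{p}\|f\|_{H_{p,\infty}^S(\mathbb{R})}\le \|f\|_{H_{p,\infty}^*(\mathbb{R})}\le C_{p}\|f\|_{H_{p,\infty}^S(\mathbb{R})}.$$
   Context: Setting: for $n\in\mathbb{N}=\{0,1,2,\dots\}$, $\mathcal{F}_n$ is the $\sigma$-algebra on $\mathbb{R}$ generated by the dyadic intervals $[k2^{-n},(k+1)2^{-n})$, $k\in\mathbb{Z}$; $\mathcal{F}$ is the $\sigma$-algebra generated by $\bigcup_n\mathcal{F}_n$; $\mathbb{P}$ is a probability measure on $(\mathbb{R},\mathcal{F})$. Put $A_j=[j,j+1)$, $j\in\mathbb{Z}$. $\mathcal{M}$ is the set of all martingales $f=(f_n)_{n\ge0}$ with respect to $(\mathcal{F}_n)$, with the convention $f_0=0$; $d_nf=f_n-f_{n-1}$ for $n\ge1$ and $d_0f=0$. Amalgam norm: $\|f\|_{L_{p,q}(\mathbb{R})}=\left(\sum_{j\in\mathbb{Z}}\left(\int_{A_j}|f|^p\,d\mathbb{P}\right)^{q/p}\right)^{1/q}$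 for $0<p,q<\infty$, and $\|f\|_{L_{p,\infty}(\mathbb{R})}=\sup_{j\in\mathbb{Z}}\left(\int_{A_j}|f|^p\,d\mathbb{P}\right)^{1/p}$. With $S(f)=\left(\sum_{n\ge0}|d_nf|^2\right)^{1/2}$ and $f^*=\sup_n|f_n|$, the spaces $H^S_{p,q}(\mathbb{R})$ and $H^*_{p,q}(\mathbb{R})$ consist of the $f\in\mathcal{M}$ for which $\|f\|_{H^S_{p,q}(\mathbb{R})}:=\|S(f)\|_{L_{p,q}(\mathbb{R})}$, respectively $\|f\|_{H^*_{p,q}(\mathbb{R})}:=\|f^*\|_{L_{p,q}(\mathbb{R})}$, is finite. *)

(* Defs.v *)
From HB Require Import structures.
From mathcomp Require Import all_boot all_order all_algebra.
From mathcomp Require Import all_classical all_reals all_analysis.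

Set Implicit Arguments.
Unset Strict Implicit.
Unset Printing Implicit Defensive.

Import Order.TTheory GRing.Theory Num.Theory.
Import numFieldNormedType.Exports.

Local Open Scope classical_set_scope.
Local Open Scope ring_scope.

Definition dyadic_intervals (R : realType) (n : nat) : set (set R) :=
  [set I | exists k : int,
    I = [set` `[k%:~R / 2 ^+ n, (k + 1)%:~R / 2 ^+ n[ ]].

(* [<<s G >>] is the sigma-algebra generated by [G], as a set of sets, and
   [g_sigma_algebraType G] the carrier of [G] equipped with it. *)
Definition dyadic_sigma (R : realType) (n : nat) : set (set R) :=
  <<s @dyadic_intervals R n >>.

(* R equipped with F_n. *)
Notation dyadicType R n := (g_sigma_algebraType (@dyadic_intervals R n)).

(* R equipped with F, the sigma-algebra generated by the union of the F_n. *)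
Notation dyadicLimType R :=
  (g_sigma_algebraType (\bigcup_n @dyadic_sigma R n)).

Definition unit_interval (R : realType) (j : int) : set R :=
  [set` `[j%:~R, (j + 1)%:~R[ ].

(* [Y] is a version of the conditional expectation of [X] given F_n. *)
Definition is_cond_exp (R : realType) (P : probability (dyadicLimType R) R)
    (n : nat) (X Y : R -> R) : Prop :=
  [/\ measurable_fun [set: dyadicType R n] (Y : dyadicType R n -> R),
      P.-integrable [set: dyadicLimType R] (EFin \o Y) &
      forall A : set R, @dyadic_sigma R n A ->
        (\int[P]_(x in A) (Y x)%:E = \int[P]_(x in A) (X x)%:E)%E].

(* The set M: martingales with respect to (F_n) starting at 0. *)
Definition dyadic_martingale (R : realType)
    (P : probability (dyadicLimType R) R) : set (nat -> R -> R) :=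
  [set f | [/\ forall x, f 0 x = 0,
     forall n, measurable_fun [set: dyadicType R n] (f n : dyadicType R n -> R),
     forall n, P.-integrable [set: dyadicLimType R] (EFin \o f n) &
     forall m n : nat, (n <= m)%N -> is_cond_exp P n (f m) (f n)]].

Definition mart_diff (R : realType) (f : nat -> R -> R) (n : nat) (x : R) : R :=
  if n is m.+1 then f m.+1 x - f m x else 0.

Definition square_function (R : realType) (f : nat -> R -> R) (x : R) : \bar R :=
  ((\sum_(0 <= n <oo) (`|mart_diff f n x| ^+ 2)%:E) `^ 2^-1)%E.

Definition maximal_function (R : realType) (f : nat -> R -> R) (x : R) : \bar R :=
  ereal_sup [set `|f n x|%:E | n in [set: nat]].

(* The value at [q = -oo] is junk; only [q >= 1] is ever used. *)
Definition amalgam_norm (R : realType) (P : probability (dyadicLimType R) R)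
    (p : R) (q : \bar R) (g : R -> \bar R) : \bar R :=
  match q with
  | r%:E => ((\esum_(j in [set: int])
       (\int[P]_(x in @unit_interval R j) (`|g x| `^ p)) `^ (r / p)) `^ r^-1)%E
  | +oo%E => ereal_sup [set
       ((\int[P]_(x in @unit_interval R j) (`|g x| `^ p)) `^ p^-1)%E
       | j in [set: int]]
  | -oo%E => 0%E
  end.

Definition HS_norm (R : realType) (P : probability (dyadicLimType R) R)
    (p : R) (q : \bar R) (f : nat -> R -> R) : \bar R :=
  amalgam_norm P p q (square_function f).

Definition Hstar_norm (R : realType) (P : probability (dyadicLimType R) R)
    (p : R) (q : \bar R) (f : nat -> R -> R) : \bar R :=
  amalgam_norm P p q (maximal_function f).

Definition HS_space (R : realType) (P : probability (dyadicLimType R) R)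
    (p : R) (q : \bar R) : set (nat -> R -> R) :=
  [set f | dyadic_martingale P f /\ (HS_norm P p q f < +oo)%E].

Definition Hstar_space (R : realType) (P : probability (dyadicLimType R) R)
    (p : R) (q : \bar R) : set (nat -> R -> R) :=
  [set f | dyadic_martingale P f /\ (Hstar_norm P p q f < +oo)%E].

(* Main.v *)
Require Import Defs.
From HB Require Import structures.
From mathcomp Require Import all_boot all_order all_algebra.
From mathcomp Require Import all_classical all_reals all_analysis.
From mathcomp Require Import measurable_realfun ring lra.

Set Implicit Arguments.
Unset Strict Implicit.
Unset Printing Implicit Defensive.

Import Order.TTheory GRing.Theory Num.Theory.
Import numFieldNormedType.Exports.

Local Open Scope classical_set_scope.
Local Open Scope ring_scope.

(* For a real sequence x with x_0 = 0 put q_n = sum_(k < n) (x_{k+1} - x_k)^2,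
   m_n = max_(i <= n) |x_i| and h_n = x_n / sqrt (q_n + m_n^2).  Following
   Beiglboeck and Siorpaes, Davis' inequalities hold pathwise:
     sqrt q_N <= 7 m_N - 2 sum_(k < N) h_k (x_{k+1} - x_k),
     m_N <= 9 sqrt q_N + 2 sum_(k < N) h_k (x_{k+1} - x_k).
   Applied to the sequence restarted at each time n, and averaged over n with
   weights equal to the increments of A_n^{p-1}, where A = sqrt q or A = m
   (Garsia's argument), they give A_N^p <= C B_N^p + sum_k G_k (x_{k+1} - x_k),
   where B is the other process and G_k depends on x_0, ..., x_k only.  On
   [j, j+1), F_n-measurable functions are constant on the 2^n dyadic atoms, so
   all integrals there are finite sums and the transform sum_k G_k d_{k+1}f has
   integral 0, whatever P is.  Letting N tend to infinity by monotone
   convergence bounds the integral over each [j, j+1), and hence the amalgam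
   norms for every q. *)

(** * Pathwise inequalities *)

Lemma ler_of_sqr (R : realDomainType) (x y : R) : 0 <= y -> x ^+ 2 <= y ^+ 2 -> x <= y.
Proof.
move=> y0 h; case: (leP x y) => // yx.
by nra.
Qed.

(* The potential [D - x^2 / D - 6 m], with D = sqrt (q + m^2), is at least
   [sqrt q - 7 m] and decreases by at least [2 (x / D) d] along a step [d]. *)
Lemma sqrt_step_upper (R : rcfType) (x d q m : R) (hx : `|x| <= m) (hq : 0 <= q) :
  let m' := Num.max m `|x + d| in
  let D := Num.sqrt (q + m ^+ 2) in
  let D' := Num.sqrt (q + d ^+ 2 + m' ^+ 2) in
  (D' - (x + d) ^+ 2 / D' - 6 * m' + 2 * (x / D * d) <= D - x ^+ 2 / D - 6 * m : Prop).
Proof.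
move=> m' D D'.
have m0 : 0 <= m by apply: le_trans hx.
have m0' : 0 <= m' by rewrite le_max m0.
have D0 : 0 <= D by apply: sqrtr_ge0.
have D0' : 0 <= D' by apply: sqrtr_ge0.
have D2 : D ^+ 2 = q + m ^+ 2 by rewrite sqr_sqrtr // addr_ge0 // sqr_ge0.
have D2' : D' ^+ 2 = q + d ^+ 2 + m' ^+ 2 by rewrite sqr_sqrtr // !addr_ge0 // sqr_ge0.
have hm : m <= m' by rewrite le_max lexx.
have hxm' : `|x + d| <= m' by rewrite le_max lexx orbT.
have hmD : m <= D by rewrite -(@ler_pXn2r _ 2) ?nnegrE // D2; lra.
have hmD' : m' <= D' by rewrite -(@ler_pXn2r _ 2) ?nnegrE // D2'; have := sqr_ge0 d; lra.
have hDD : D <= D'.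
  rewrite -(@ler_pXn2r _ 2) ?nnegrE // D2 D2'; have := sqr_ge0 d.
  have : m ^+ 2 <= m' ^+ 2 by rewrite ler_pXn2r ?nnegrE.
  lra.
have xx' : (x + d) ^+ 2 <= m' ^+ 2 by rewrite -real_normK ?num_real // ler_pXn2r ?nnegrE.
(* If [D = 0], then [x], [q] and [m] vanish, and so do the quotients by [D] because [0^-1 = 0]. What
   remains is a first jump from rest, with [m' = |d|] and [D' <= 2 * m']. *)
move: (D0); rewrite le_eqVlt => /orP[/eqP D00|Dp].
  have mz : m = 0 by apply/eqP; rewrite eq_le m0 andbT D00.
  have xz : x = 0 by apply/eqP; rewrite -normr_le0 -mz.
  have qz : q = 0 by move: D2; rewrite -D00 mz; lra.
  rewrite -D00 invr0 !(mulr0, mul0r, addr0, subr0) mz mulr0 subr0 xz add0r.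
  have hm' : m' = `|d| by rewrite /m' mz xz add0r max_r.
  have : D' <= 2 * m'.
    rewrite -(@ler_pXn2r _ 2) ?nnegrE ?mulr_ge0 // D2' qz add0r exprMn hm' real_normK ?num_real //.
    have := sqr_ge0 d; lra.
  have : 0 <= d ^+ 2 / D' by rewrite divr_ge0 // sqr_ge0.
  lra.
have Dp' : 0 < D' by apply: lt_le_trans hDD.
have Dn : D != 0 by rewrite gt_eqF.
have Dn' : D' != 0 by rewrite gt_eqF.
(* The hedge is chosen so that [x ^+ 2 + 2 * x * d = (x + d) ^+ 2 - d ^+ 2] eliminates the old
   position. *)
have eqT : D' - (x + d) ^+ 2 / D' + 2 * (x / D * d) - (D - x ^+ 2 / D) =
   D' - D - (x + d) ^+ 2 / D' + ((x + d) ^+ 2 - d ^+ 2) / D.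
  by field; rewrite Dn Dn'.
suff : D' - D - (x + d) ^+ 2 / D' + ((x + d) ^+ 2 - d ^+ 2) / D <= 6 * (m' - m) by move: eqT; lra.
(* Without a new maximum, [d ^+ 2 = D' ^+ 2 - D ^+ 2] factors the left side into [D' - D >= 0] and a
   nonpositive term. *)
case: (leP `|x + d| m) => [le|gt].
  have e : m' = m by rewrite /m' max_l.
  rewrite e subrr mulr0.
  have -> : D' - D - (x + d) ^+ 2 / D' + ((x + d) ^+ 2 - d ^+ 2) / D =
     (D' - D) * (((x + d) ^+ 2 - D' ^+ 2) / (D * D')).
    have -> : d ^+ 2 = D' ^+ 2 - D ^+ 2 by rewrite D2 D2' e; ring.
    by field; rewrite Dn Dn'.
  rewrite mulr_ge0_le0 ?subr_ge0 // mulr_le0_ge0 ?invr_ge0 ?mulr_ge0 //.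
  rewrite subr_le0 D2' (le_trans xx') //; have := sqr_ge0 d; lra.
have e : m' = `|x + d| by rewrite /m' max_r // ltW.
have e2 : (x + d) ^+ 2 = m' ^+ 2 by rewrite e real_normK ?num_real.
rewrite e2.
have hd : `|d| <= m' + m.
  have -> : d = (x + d) - x by ring.
  by rewrite (le_trans (ler_normB _ _)) // e lerD2l.
have d2 : d ^+ 2 = `|d| ^+ 2 by rewrite real_normK ?num_real.
(* For a moderate new maximum, [D'] may be replaced by [E], which omits [d ^+ 2]. The resulting
   [(E - D) * (1 + (m' / D) * (m' / E))] is at most [(m' - m) * (1 + 5)], whence the constant 6.
   Beyond [5 * D], the crude bounds leave [D + 4 * m'], which is below [6 * (m' - m)] because
   [m <= D]. *)
case: (leP m' (5 * D)) => [small|big].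
  pose E := Num.sqrt (q + m' ^+ 2).
  have E0 : 0 <= E by apply: sqrtr_ge0.
  have E2 : E ^+ 2 = q + m' ^+ 2 by rewrite sqr_sqrtr // addr_ge0 // sqr_ge0.
  have mE : m' <= E by rewrite -(@ler_pXn2r _ 2) ?nnegrE // E2; lra.
  have DE : D <= E.
    by rewrite -(@ler_pXn2r _ 2) ?nnegrE // E2 D2 lerD2l ler_pXn2r ?nnegrE.
  have ED : E <= D'.
    by rewrite -(@ler_pXn2r _ 2) ?nnegrE // E2 D2'; have := sqr_ge0 d; lra.
  have Ep : 0 < E by apply: lt_le_trans DE.
  have En : E != 0 by rewrite gt_eqF.
  have EDm : E - D <= m' - m.
    have : E <= D + (m' - m); last by lra.
    apply: ler_of_sqr; [lra|rewrite E2 sqrrD D2].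
    have : m * (m' - m) <= D * (m' - m) by rewrite ler_wpM2r // subr_ge0.
    rewrite -mulr_natl; nra.
  have step1 : D' - D - m' ^+ 2 / D' + (m' ^+ 2 - d ^+ 2) / D <=
     E - D - m' ^+ 2 / E + m' ^+ 2 / D.
    rewrite -subr_ge0.
    have -> : E - D - m' ^+ 2 / E + m' ^+ 2 / D - (D' - D - m' ^+ 2 / D' + (m' ^+ 2 - d ^+ 2) / D) =
      (D' - E) * ((D' + E) / D - 1 - m' ^+ 2 / (E * D')).
      have -> : d ^+ 2 = D' ^+ 2 - E ^+ 2 by rewrite E2 D2'; ring.
      by field; rewrite Dn Dn' En.
    rewrite mulr_ge0 ?subr_ge0 //.
    have h1 : 1 <= D' / D by rewrite ler_pdivlMr // mul1r.
    have h2 : m' ^+ 2 / (E * D') <= 1.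
      by rewrite ler_pdivrMr ?mulr_gt0 // mul1r expr2 ler_pM.
    have h3 : 1 <= E / D by rewrite ler_pdivlMr // mul1r.
    rewrite mulrDl; lra.
  apply: (le_trans step1).
  have -> : E - D - m' ^+ 2 / E + m' ^+ 2 / D = (E - D) * (1 + (m' / D) * (m' / E)).
    by field; rewrite Dn En.
  have h1 : m' / D <= 5 by rewrite ler_pdivrMr.
  have h2 : m' / E <= 1 by rewrite ler_pdivrMr // mul1r.
  have h3 : (m' / D) * (m' / E) <= 5 * 1 by rewrite ler_pM // divr_ge0.
  rewrite [leRHS]mulrC ler_pM ?subr_ge0 ?addr_ge0 ?mulr_ge0 ?invr_ge0 //; lra.
have h1 : D' <= 2 * D + 2 * m'.
  rewrite -(@ler_pXn2r _ 2) ?nnegrE ?addr_ge0 ?mulr_ge0 // D2'.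
  have : d ^+ 2 <= (m' + D) ^+ 2.
    by rewrite d2 ler_pXn2r ?nnegrE ?addr_ge0 // (le_trans hd) // lerD2l.
  have : 0 <= D * m' by rewrite mulr_ge0.
  have := sqr_ge0 m; nra.
have h2 : (m' ^+ 2 - d ^+ 2) / D <= 2 * m'.
  rewrite ler_pdivrMr // -e2.
  have -> : (x + d) ^+ 2 - d ^+ 2 = 2 * (x * (x + d)) - x ^+ 2 by ring.
  have : x * (x + d) <= D * m'.
    rewrite (le_trans (ler_norm _)) // normrM ler_pM // (le_trans hx) //.
  have := sqr_ge0 x; lra.
have h3 : 0 <= m' ^+ 2 / D' by rewrite divr_ge0 // sqr_ge0.
lra.
Qed.

(* Same mechanism, with a potential that is at least [m - 9 sqrt q]. *)
Lemma max_step_upper (R : rcfType) (x d q m : R) (hx : `|x| <= m) (hq : 0 <= q) :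
  let m' := Num.max m `|x + d| in
  let D := Num.sqrt (q + m ^+ 2) in
  let D' := Num.sqrt (q + d ^+ 2 + m' ^+ 2) in
  (((x + d) ^+ 2 + (q + d ^+ 2)) / D' + D' - 9 * Num.sqrt (q + d ^+ 2) - 2 * (x / D * d)
   <= (x ^+ 2 + q) / D + D - 9 * Num.sqrt q : Prop).
Proof.
move=> m' D D'; pose s := Num.sqrt q; pose s' := Num.sqrt (q + d ^+ 2).
rewrite -/s -/s'.
have m0 : 0 <= m by apply: le_trans hx.
have m0' : 0 <= m' by rewrite le_max m0.
have hq' : 0 <= q + d ^+ 2 by rewrite addr_ge0 // sqr_ge0.
have D0 : 0 <= D by apply: sqrtr_ge0.
have D0' : 0 <= D' by apply: sqrtr_ge0.
have s0 : 0 <= s by apply: sqrtr_ge0.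
have s0' : 0 <= s' by apply: sqrtr_ge0.
have D2 : D ^+ 2 = q + m ^+ 2 by rewrite sqr_sqrtr // addr_ge0 // sqr_ge0.
have D2' : D' ^+ 2 = q + d ^+ 2 + m' ^+ 2 by rewrite sqr_sqrtr // !addr_ge0 // sqr_ge0.
have s2 : s ^+ 2 = q by rewrite sqr_sqrtr.
have s2' : s' ^+ 2 = q + d ^+ 2 by rewrite sqr_sqrtr.
have hm : m <= m' by rewrite le_max lexx.
have hmD : m <= D by rewrite -(@ler_pXn2r _ 2) ?nnegrE // D2; lra.
have hsD : s <= D by rewrite -(@ler_pXn2r _ 2) ?nnegrE // D2 s2; have := sqr_ge0 m; lra.
have hss : s <= s' by rewrite -(@ler_pXn2r _ 2) ?nnegrE // s2 s2'; have := sqr_ge0 d; lra.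
have hDD : D <= D'.
  rewrite -(@ler_pXn2r _ 2) ?nnegrE // D2 D2'; have := sqr_ge0 d.
  have : m ^+ 2 <= m' ^+ 2 by rewrite ler_pXn2r ?nnegrE.
  lra.
have d2 : d ^+ 2 = `|d| ^+ 2 by rewrite real_normK ?num_real.
have a0 : 0 <= `|d| by apply: normr_ge0.
have hds : `|d| <= s' by rewrite -(@ler_pXn2r _ 2) ?nnegrE // s2' -d2; lra.
have hs'd : s' <= s + `|d|.
  rewrite -(@ler_pXn2r _ 2) ?nnegrE ?addr_ge0 // s2' sqrrD s2 -d2.
  have : 0 <= s * `|d| by rewrite mulr_ge0.
  rewrite -mulr_natl; lra.
have dE : d ^+ 2 = (s' - s) * (s' + s).
  have -> : d ^+ 2 = s' ^+ 2 - s ^+ 2 by rewrite s2 s2'; ring.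
  by ring.
move: (D0); rewrite le_eqVlt => /orP[/eqP D00|Dp].
  have mz : m = 0 by apply/eqP; rewrite eq_le m0 andbT D00.
  have xz : x = 0 by apply/eqP; rewrite -normr_le0 -mz.
  have qz : q = 0 by move: D2; rewrite -D00 mz; lra.
  have sz : s = 0 by apply/eqP; rewrite eq_le s0 andbT D00.
  rewrite -D00 invr0 !(mulr0, mul0r, addr0, subr0) sz mulr0 xz qz !add0r ?subr0.
  have hm' : m' = `|d| by rewrite /m' mz xz add0r max_r.
  have e : d ^+ 2 + d ^+ 2 = D' ^+ 2 by rewrite D2' qz add0r hm' d2.
  have : D' <= 2 * `|d|.
    rewrite -(@ler_pXn2r _ 2) ?nnegrE ?mulr_ge0 // -e exprMn -d2.
    have := sqr_ge0 d; lra.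
  have : D' ^+ 2 / D' <= D'.
    move: D0'; rewrite le_eqVlt => /orP[/eqP <-|?]; first by rewrite invr0 mulr0.
    by rewrite expr2 mulfK // gt_eqF.
  rewrite e; lra.
have Dp' : 0 < D' by apply: lt_le_trans hDD.
have Dn : D != 0 by rewrite gt_eqF.
have Dn' : D' != 0 by rewrite gt_eqF.
have eqT : ((x + d) ^+ 2 + (q + d ^+ 2)) / D' + D' - 2 * (x / D * d)
   - ((x ^+ 2 + q) / D + D) =
   ((x + d) ^+ 2 + (q + d ^+ 2)) / D' + D' - (((x + d) ^+ 2 + q - d ^+ 2) / D + D).
  by field; rewrite Dn Dn'.
suff : ((x + d) ^+ 2 + (q + d ^+ 2)) / D' + D' - (((x + d) ^+ 2 + q - d ^+ 2) / D + D)
   <= 9 * (s' - s) by move: eqT; lra.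
(* Without a new maximum, the bounds [d ^+ 2 / D <= 4 * (s' - s)], used twice, and
   [D' - D <= s' - s] add up to the constant 9. With a new maximum, 6 would do. *)
case: (leP `|x + d| m) => [le|gt].
  have e : m' = m by rewrite /m' max_l.
  have hD : D' - D <= s' - s.
    have : D' <= D + (s' - s); last by lra.
    apply: ler_of_sqr; [lra|rewrite D2' e sqrrD D2].
    have : s * (s' - s) <= D * (s' - s) by rewrite ler_wpM2r // subr_ge0.
    rewrite -mulr_natl; nra.
  have hd : `|d| <= 2 * m.
    have -> : d = (x + d) - x by ring.
    by rewrite (le_trans (ler_normB _ _)) //; lra.
  have hdD : d ^+ 2 / D <= 4 * (s' - s).
    rewrite ler_pdivrMr // dE.
    have : (s' - s) * (s' + s) <= (s' - s) * (4 * D).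
      by rewrite ler_wpM2l ?subr_ge0 //; lra.
    lra.
  have h1 : ((x + d) ^+ 2 + (q + d ^+ 2)) / D' <= ((x + d) ^+ 2 + (q + d ^+ 2)) / D.
    by rewrite ler_wpM2l ?addr_ge0 ?sqr_ge0 // lef_pV2 // posrE.
  have h2 : ((x + d) ^+ 2 + (q + d ^+ 2)) / D = ((x + d) ^+ 2 + q - d ^+ 2) / D + 2 * (d ^+ 2 / D).
    by field.
  rewrite h2 in h1; lra.
have e : m' = `|x + d| by rewrite /m' max_r // ltW.
have e2 : (x + d) ^+ 2 = m' ^+ 2 by rewrite e real_normK ?num_real.
rewrite e2.
have -> : (m' ^+ 2 + (q + d ^+ 2)) / D' = D'.
  by rewrite addrC -D2' expr2 mulfK.
pose E := Num.sqrt (q + m' ^+ 2).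
have E0 : 0 <= E by apply: sqrtr_ge0.
have E2 : E ^+ 2 = q + m' ^+ 2 by rewrite sqr_sqrtr // addr_ge0 // sqr_ge0.
have mE : m' <= E by rewrite -(@ler_pXn2r _ 2) ?nnegrE // E2; lra.
have sE : s <= E by rewrite -(@ler_pXn2r _ 2) ?nnegrE // E2 s2; have := sqr_ge0 m'; lra.
have hD : D' <= E + (s' - s).
  apply: ler_of_sqr; [lra|rewrite D2' sqrrD E2].
  have : s * (s' - s) <= E * (s' - s) by rewrite ler_wpM2r // subr_ge0.
  rewrite -mulr_natl; nra.
(* A small jump has [s' + s <= 4 * D]. After a large one, [E - D] is at least [|d| - 2 * D], so that
   the square of [E - D] cancels [d ^+ 2] up to [4 * D * (|d| - D)]. *)
have key : (d ^+ 2 - (E - D) ^+ 2) / D <= 4 * (s' - s).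
  rewrite ler_pdivrMr //.
  case: (leP `|d| (2 * D)) => [small|big].
    have : (s' - s) * (s' + s) <= (s' - s) * (4 * D).
      by rewrite ler_wpM2l ?subr_ge0 //; lra.
    rewrite dE; have := sqr_ge0 (E - D); lra.
  have hE : `|d| - 2 * D <= E - D.
    have : `|d| <= m' + m.
      have -> : d = (x + d) - x by ring.
      by rewrite (le_trans (ler_normB _ _)) // e lerD2l.
    lra.
  have : (`|d| - 2 * D) ^+ 2 <= (E - D) ^+ 2.
    by rewrite ler_pXn2r ?nnegrE //; lra.
  have : D * (`|d| - D) <= D * (s' - s) by rewrite ler_wpM2l //; lra.
  rewrite d2; nra.
have : D' + D' - ((m' ^+ 2 + q - d ^+ 2) / D + D) = 2 * (D' - E) + (d ^+ 2 - (E - D) ^+ 2) / D.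
  have -> : m' ^+ 2 = E ^+ 2 - q by rewrite E2; ring.
  by field.
lra.
Qed.

(** * Davis' inequalities along a single path *)

Definition quad_var {R : ringType} (x : nat -> R) (n : nat) : R :=
  \sum_(i < n) (x i.+1 - x i) ^+ 2.

Fixpoint running_max {R : numDomainType} (x : nat -> R) (n : nat) : R :=
  if n is m.+1 then Num.max (running_max x m) `|x m.+1| else `|x 0|.

Definition hedge {R : rcfType} (x : nat -> R) (n : nat) : R :=
  x n / Num.sqrt (quad_var x n + running_max x n ^+ 2).

Lemma quad_varS {R : ringType} (x : nat -> R) n :
  quad_var x n.+1 = quad_var x n + (x n.+1 - x n) ^+ 2.
Proof. by rewrite /quad_var big_ord_recr. Qed.

Lemma quad_var_ge0 {R : realDomainType} (x : nat -> R) n : 0 <= quad_var x n.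
Proof. by apply: sumr_ge0 => i _; rewrite sqr_ge0. Qed.

Lemma quad_var_eq {R : ringType} (x y : nat -> R) n :
  (forall i, (i <= n)%N -> x i = y i) -> quad_var x n = quad_var y n.
Proof.
by move=> xy; apply: eq_bigr => i _; rewrite !xy // ltnW.
Qed.

Lemma quad_varD {R : ringType} (x : nat -> R) n k :
  quad_var x (n + k) = quad_var x n + quad_var (fun i => x (n + i)%N - x n) k.
Proof.
elim: k => [|k IH]; first by rewrite /quad_var big_ord0 addr0 addn0.
by rewrite addnS !quad_varS IH addrA addnS opprB addrA subrK.
Qed.

Lemma norm_le_running_max {R : realDomainType} (x : nat -> R) n i :
  (i <= n)%N -> `|x i| <= running_max x n.
Proof.
elim: n => [|n IH]; first by rewrite leqn0 => /eqP ->.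
by rewrite leq_eqVlt le_max => /orP[/eqP ->|/IH ->//]; rewrite lexx orbT.
Qed.

Lemma running_max_le {R : realDomainType} (x : nat -> R) n b :
  (forall i, (i <= n)%N -> `|x i| <= b) -> running_max x n <= b.
Proof.
elim: n => [|n IH] h /=; first exact: h.
by rewrite ge_max h // andbT IH // => i le; apply: h; apply: leqW.
Qed.

Lemma running_max_ge0 {R : realDomainType} (x : nat -> R) n : 0 <= running_max x n.
Proof. exact: le_trans (normr_ge0 _) (norm_le_running_max x (leqnn n)). Qed.

Lemma running_max_eq {R : realDomainType} (x y : nat -> R) n :
  (forall i, (i <= n)%N -> x i = y i) -> running_max x n = running_max y n.
Proof.
elim: n => [|n IH] h /=; first by rewrite h.
by rewrite h // IH // => i le; apply: h; apply: leqW.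
Qed.

Lemma hedge_eq {R : rcfType} (x y : nat -> R) n :
  (forall i, (i <= n)%N -> x i = y i) -> hedge x n = hedge y n.
Proof.
by move=> h; rewrite /hedge (quad_var_eq h) (running_max_eq h) h.
Qed.

(** The one-step estimate telescopes from a potential that is 0 at time 0. At time [n], the bound
    [x ^+ 2 / D <= m] turns the coefficient 6 into 7. *)
Lemma sqrt_quad_var_le {R : rcfType} (x : nat -> R) n : x 0 = 0 ->
  Num.sqrt (quad_var x n) <=
  7 * running_max x n - 2 * \sum_(k < n) hedge x k * (x k.+1 - x k).
Proof.
move=> x0; pose D n := Num.sqrt (quad_var x n + running_max x n ^+ 2).
have q0 := quad_var_ge0 x n; have m0 := running_max_ge0 x n.
have xm := norm_le_running_max x (leqnn n).
have H : D n - x n ^+ 2 / D n - 6 * running_max x n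
     + 2 * \sum_(k < n) hedge x k * (x k.+1 - x k) <= 0.
  elim: (n) => [|k IH].
    rewrite big_ord0 mulr0 addr0 /D /quad_var big_ord0 /= x0 normr0.
    by rewrite !expr0n /= mulr0n addr0 sqrtr0 mulr0 mul0r !subr0.
  have := @sqrt_step_upper _ (x k) (x k.+1 - x k) _ _ (norm_le_running_max x (leqnn k)) (quad_var_ge0 x k).
  rewrite /= [x k + _]addrC subrK -quad_varS -/(running_max x k.+1) -/(D _) -/(D k.+1).
  move: IH; rewrite big_ord_recr /= mulrDr /hedge -/(D k); lra.
have h1 : Num.sqrt (quad_var x n) <= D n.
  by rewrite ler_wsqrtr // lerDl sqr_ge0.
have h2 : running_max x n <= D n.
  by rewrite -(@ler_pXn2r _ 2) ?nnegrE ?sqrtr_ge0 // sqr_sqrtr ?addr_ge0 ?sqr_ge0 // lerDr.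
have h3 : x n ^+ 2 / D n <= running_max x n.
  have [D0|Dp] := leP (D n) 0.
    have -> : D n = 0 by apply/eqP; rewrite eq_le D0 sqrtr_ge0.
    by rewrite invr0 mulr0.
  rewrite ler_pdivrMr // -real_normK ?num_real // expr2 ler_pM //.
  exact: le_trans h2.
lra.
Qed.

(** The same telescoping. At time [n] the nonnegative quotient is dropped and [D] is bounded below
    by the running maximum. *)
Lemma running_max_le_sqrt {R : rcfType} (x : nat -> R) n : x 0 = 0 ->
  running_max x n <=
  9 * Num.sqrt (quad_var x n) + 2 * \sum_(k < n) hedge x k * (x k.+1 - x k).
Proof.
move=> x0; pose D n := Num.sqrt (quad_var x n + running_max x n ^+ 2).
have q0 := quad_var_ge0 x n; have m0 := running_max_ge0 x n.
have H : (x n ^+ 2 + quad_var x n) / D n + D n - 9 * Num.sqrt (quad_var x n)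
     <= 2 * \sum_(k < n) hedge x k * (x k.+1 - x k).
  elim: (n) => [|k IH].
    rewrite big_ord0 mulr0 /D /quad_var big_ord0 /= x0 normr0.
    by rewrite !expr0n /= mulr0n addr0 sqrtr0 mulr0 mul0r !addr0 subr0.
  have := @max_step_upper _ (x k) (x k.+1 - x k) _ _ (norm_le_running_max x (leqnn k)) (quad_var_ge0 x k).
  rewrite /= [x k + _]addrC subrK -quad_varS -/(running_max x k.+1) -/(D _) -/(D k.+1).
  move: IH; rewrite big_ord_recr /= mulrDr /hedge -/(D k); lra.
have h2 : running_max x n <= D n.
  by rewrite -(@ler_pXn2r _ 2) ?nnegrE ?sqrtr_ge0 // sqr_sqrtr ?addr_ge0 ?sqr_ge0 // lerDr.
have h3 : 0 <= (x n ^+ 2 + quad_var x n) / D n.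
  by rewrite divr_ge0 ?sqrtr_ge0 // addr_ge0 // sqr_ge0.
lra.
Qed.

(** * Garsia's argument for p-th powers *)

Definition nonanticipating {R : Type} (G : nat -> (nat -> R) -> R) :=
  forall k x y, (forall i, (i <= k)%N -> x i = y i) -> G k x = G k y.

(** This is the tangent bound for the convex power at [a]. For [p > 1] it is Young's inequality with
    exponents [p] and [p / (p - 1)], applied to [b] and [a ^ (p - 1)]. *)
Lemma powR_sub_le {R : realType} (a b p : R) : 1 <= p -> 0 <= b <= a ->
  a `^ p - b `^ p <= p * (a `^ (p - 1) * (a - b)).
Proof.
move=> p1 /andP[b0 ba]; have a0 : 0 <= a by apply: le_trans ba.
have p0 : 0 < p by lra.
have e : a `^ p = a `^ (p - 1) * a by rewrite mulrC mulr_powRB1.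
suff : p * (a `^ (p - 1) * b) <= b `^ p + (p - 1) * a `^ p by rewrite e; lra.
move: p1; rewrite le_eqVlt => /orP[/eqP <-|p1].
  by rewrite subrr powRr0 mul0r addr0 !mul1r powRr1.
have q0 : 0 < p - 1 by lra.
have := @conjugate_powR _ b (a `^ (p - 1)) p (p / (p - 1)) b0 (powR_ge0 _ _) p0 (divr_gt0 p0 q0).
rewrite -powRrM [(p - 1) * _]mulrC divfK ?gt_eqF // invf_div.
have -> : p^-1 + (p - 1) / p = 1 by field; rewrite gt_eqF.
move=> /(_ erefl) h.
have := ler_wpM2l (ltW p0) h.
suff -> : p * (b `^ p / p + a `^ p * ((p - 1) / p)) = b `^ p + (p - 1) * a `^ p.
  by rewrite [b * _]mulrC.
by field; rewrite gt_eqF.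
Qed.

(** According to whether [2 * C * b] is below or above [a], the left side is dominated by the first
    or the second term alone. The factor 1/2 allows [a ^ p] to be absorbed later. *)
Lemma powR_young {R : realType} (a b p C : R) : 1 <= p -> 0 <= C -> 0 <= a -> 0 <= b ->
  C * (b * a `^ (p - 1)) <= 2^-1 * a `^ p + 2^-1 * ((2 * C) `^ p * b `^ p).
Proof.
move=> p1 C0 a0 b0; have p0 : 0 < p by lra.
have Cb : 0 <= 2 * C * b by rewrite !mulr_ge0.
have w0 := powR_ge0 a (p - 1).
rewrite -powRM // ?mulr_ge0 //.
have e y : 0 <= y -> y `^ p = y * y `^ (p - 1) by move=> ?; rewrite mulr_powRB1.
case: (leP (2 * C * b) a) => [le|lt].
  have : 2 * C * b * a `^ (p - 1) <= a `^ p by rewrite e // ler_wpM2r.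
  have := powR_ge0 (2 * C * b) p; lra.
have : a `^ (p - 1) <= (2 * C * b) `^ (p - 1).
  by apply: ge0_ler_powR; rewrite ?nnegrE //; [lra | exact: ltW].
move=> h; have := ler_wpM2l Cb h; rewrite -e //.
have := powR_ge0 a p; lra.
Qed.

(** Abel summation trades the weighted increments of [A], which control its p-th power, for the
    remainders [A N - A n], which the restarted inequality controls. *)
Lemma sum_by_parts {R : comRingType} (W A : nat -> R) N : W 0 = 0 ->
  \sum_(n < N) (W n.+1 - W n) * (A N - A n) = \sum_(n < N) W n.+1 * (A n.+1 - A n).
Proof.
move=> W0; elim: N => [|N IH]; first by rewrite !big_ord0.
rewrite big_ord_recr [in RHS]big_ord_recr /= -IH.
have -> : \sum_(i < N) (W i.+1 - W i) * (A N.+1 - A i) =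
  \sum_(i < N) (W i.+1 - W i) * (A N - A i) + \sum_(i < N) (W i.+1 - W i) * (A N.+1 - A N).
  by rewrite -big_split; apply: eq_bigr => i _ /=; ring.
rewrite -mulr_suml -(big_mkord xpredT (fun i => W i.+1 - W i)) telescope_sumr // W0.
by ring.
Qed.

(* Summing the hypothesis against the weights [A_{n+1}^(p-1) - A_n^(p-1)] bounds
   [A_N^p] by [B_N A_N^(p-1)], and Young's inequality absorbs the last factor. *)
Lemma pathwise_garsia {R : realType} (p c : R) (A B : nat -> (nat -> R) -> R)
    (g : nat -> nat -> (nat -> R) -> R) : 1 <= p -> 0 <= c ->
  nonanticipating A -> (forall n, nonanticipating (g n)) ->
  (forall n k x, (k <= n)%N -> g n k x = 0) ->
  (forall x, x 0 = 0 -> A 0 x = 0) ->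
  (forall n x, A n x <= A n.+1 x) ->
  (forall n x, 0 <= B n x) ->
  (forall x n N, x 0 = 0 -> (n <= N)%N ->
    A N x - A n x <= c * B N x + \sum_(k < N) g n k x * (x k.+1 - x k)) ->
  exists2 G, nonanticipating G & forall x N, x 0 = 0 ->
    A N x `^ p <= (2 * (p * c)) `^ p * B N x `^ p + \sum_(k < N) G k x * (x k.+1 - x k).
Proof.
move=> p1 c0 nA ng gz A0 Amono B0 AB.
have p0 : 0 < p by lra.
(* [W 0] must vanish, whereas [0 `^ 0 = 1] when [p = 1]. *)
pose W n x : R := if n is _.+1 then A n x `^ (p - 1) else 0.
have nW : nonanticipating W.
  by move=> [|n] x y xy //=; rewrite (nA n.+1 x y).
(* The factor [p] comes from the tangent bound, and the factor 2 from absorbing half of the p-th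
   power of [A]. *)
exists (fun k x => 2 * p * \sum_(n < k) (W n.+1 x - W n x) * g n k x).
  move=> k x y xy; congr (_ * _); apply: eq_bigr => n _.
  rewrite (ng n k x y) // (nW n.+1 x y); last first.
    by move=> i le; apply: xy; apply: leq_trans le _.
  by rewrite (nW n x y) // => i le; apply: xy; apply: leq_trans le (ltnW _).
move=> x N x0.
have Age0 n : 0 <= A n x by elim: n => [|n IH]; rewrite ?A0 // (le_trans IH).
(* Only at positive times is [W] the power of [A], so time 0 is treated apart. *)
case: N => [|N]; first by rewrite A0 // powR0 ?gt_eqF // big_ord0 addr0 mulr_ge0 ?powR_ge0.
have dW n : 0 <= W n.+1 x - W n x.
  rewrite subr_ge0; case: n => [|n] /=; first exact: powR_ge0.
  by apply: ge0_ler_powR; rewrite ?nnegrE // subr_ge0.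
have h1 : A N.+1 x `^ p <= p * \sum_(n < N.+1) W n.+1 x * (A n.+1 x - A n x).
  elim: (N.+1) => [|n IH]; first by rewrite A0 // powR0 ?gt_eqF // big_ord0 mulr0.
  rewrite big_ord_recr mulrDr /=.
  have := @powR_sub_le _ (A n.+1 x) (A n x) p p1; rewrite Age0 Amono => /(_ isT).
  move: IH; lra.
move: h1; rewrite -(@sum_by_parts _ (W ^~ x) (A ^~ x)) // => h1.
have h2 : \sum_(n < N.+1) (W n.+1 x - W n x) * (A N.+1 x - A n x) <=
    \sum_(n < N.+1) (W n.+1 x - W n x) * (c * B N.+1 x + \sum_(k < N.+1) g n k x * (x k.+1 - x k)).
  by apply: ler_sum => n _; rewrite ler_wpM2l // AB // ltnW.
have h3 : \sum_(n < N.+1) (W n.+1 x - W n x) * (c * B N.+1 x + \sum_(k < N.+1) g n k x * (x k.+1 - x k))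
   = c * (B N.+1 x * A N.+1 x `^ (p - 1)) +
     \sum_(k < N.+1) (\sum_(n < k) (W n.+1 x - W n x) * g n k x) * (x k.+1 - x k).
  under eq_bigr do rewrite mulrDr mulr_sumr.
  rewrite big_split /= exchange_big /=; congr (_ + _).
    rewrite -mulr_suml -(big_mkord xpredT (fun i => W i.+1 x - W i x)) telescope_sumr //= subr0.
    by ring.
  apply: eq_bigr => k _; rewrite mulr_suml.
  rewrite -(big_mkord xpredT (fun i => (W i.+1 x - W i x) * (g i k x * (x k.+1 - x k)))).
  (* The terms with [k <= n] vanish, and the others carry weights known at time [n.+1 <= k]. *)
  rewrite (big_cat_nat (leq0n k) (ltnW (ltn_ord k))) /= [X in _ + X]big_nat_cond.
  rewrite [X in _ + X]big1 ?addr0 ?big_mkord => [|i /andP[/andP[ki _] _]].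
    by apply: eq_bigr => i _; rewrite mulrA.
  by rewrite gz // mul0r mulr0.
rewrite h3 in h2.
have h4 := powR_young p1 (mulr_ge0 (ltW p0) c0) (Age0 N.+1) (B0 N.+1 x).
have h5 := ler_wpM2l (ltW p0) h2.
have -> : \sum_(k < N.+1) 2 * p * (\sum_(n < k) (W n.+1 x - W n x) * g n k x) * (x k.+1 - x k) =
  2 * p * \sum_(k < N.+1) (\sum_(n < k) (W n.+1 x - W n x) * g n k x) * (x k.+1 - x k).
  by rewrite mulr_sumr; apply: eq_bigr => k _; rewrite mulrA.
move: h1 h4 h5; lra.
Qed.

Definition restart {R : zmodType} (n : nat) (x : nat -> R) : nat -> R :=
  fun i => x (n + i)%N - x n.

(* Starting at time [n + 1] loses nothing, since the restarted sequence vanishes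
   at [n], and allows multiplication by a weight known at time [n + 1]. *)
Definition restarted_hedge {R : rcfType} (a : R) (n k : nat) (x : nat -> R) : R :=
  if (k <= n)%N then 0 else a * hedge (restart n x) (k - n).

Lemma restarted_hedge_nonanticipating {R : rcfType} (a : R) n :
  nonanticipating (restarted_hedge a n).
Proof.
move=> k x y xy; rewrite /restarted_hedge; case: leqP => // nk; congr (_ * _).
apply: hedge_eq => i le; rewrite /restart !xy //; first exact: ltnW.
by rewrite -leq_subRL // ltnW.
Qed.

Lemma sum_restarted_hedge {R : rcfType} (a : R) n N x :
  \sum_(k < n + N) restarted_hedge a n k x * (x k.+1 - x k) =
  a * \sum_(k < N) hedge (restart n x) k * (restart n x k.+1 - restart n x k).
Proof.
rewrite big_split_ord /= big1 ?add0r => [|i _]; last first.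
  by rewrite /restarted_hedge ltnW ?mul0r.
rewrite mulr_sumr; apply: eq_bigr => k _.
rewrite /restarted_hedge addKn; case: leqP => [le|_].
  have -> : k = 0%N :> nat by apply/eqP; rewrite -leqn0 -(leq_add2l n) addn0.
  by rewrite /hedge /restart addn0 subrr !mul0r mulr0.
by rewrite /restart addnS opprB addrA subrK mulrA.
Qed.

(** Here 14 is 7 times 2: the maximum of a restarted path is at most twice that of the path.
    Subadditivity of the square root bounds the increment of the square function by that of the
    restarted path. *)
Lemma pathwise_square_le_max {R : realType} (p : R) : 1 <= p ->
  exists2 G, nonanticipating G & forall x N, x 0 = 0 ->
    Num.sqrt (quad_var x N) `^ p <= (2 * (p * 14)) `^ p * running_max x N `^ p
      + \sum_(k < N) G k x * (x k.+1 - x k).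
Proof.
move=> p1; apply: (pathwise_garsia (A := fun n x => Num.sqrt (quad_var x n))
  (B := fun n x => running_max x n) (g := restarted_hedge (- 2)) p1) => //.
- by move=> k x y xy; rewrite (quad_var_eq xy).
- exact: restarted_hedge_nonanticipating.
- by move=> n k x kn; rewrite /restarted_hedge kn.
- by move=> x _; rewrite /quad_var big_ord0 sqrtr0.
- by move=> n x; rewrite ler_wsqrtr // quad_varS lerDl sqr_ge0.
- by move=> n x; exact: running_max_ge0.
move=> x n N x0 nN; rewrite -(subnKC nN) sum_restarted_hedge; set M := (N - n)%N.
have r0 : restart n x 0 = 0 by rewrite /restart addn0 subrr.
have h1 := sqrt_quad_var_le M r0.
have h2 : running_max (restart n x) M <= 2 * running_max x (n + M).
  apply: running_max_le => i iM; rewrite (le_trans (ler_normB _ _)) // mulr_natl.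
  by rewrite lerD // norm_le_running_max // ?leq_add2l // leq_addr.
have h3 : Num.sqrt (quad_var x (n + M)) <=
   Num.sqrt (quad_var x n) + Num.sqrt (quad_var (restart n x) M).
  have q1 := quad_var_ge0 x n; have q2 := quad_var_ge0 (restart n x) M.
  apply: ler_of_sqr; first by rewrite addr_ge0 ?sqrtr_ge0.
  rewrite quad_varD sqrrD !sqr_sqrtr ?addr_ge0 //.
  by rewrite addrAC lerDl mulrn_wge0 // mulr_ge0 ?sqrtr_ge0.
lra.
Qed.

(** The constant 9 is kept, since restarting does not increase the quadratic variation. *)
Lemma pathwise_max_le_square {R : realType} (p : R) : 1 <= p ->
  exists2 G, nonanticipating G & forall x N, x 0 = 0 ->
    running_max x N `^ p <= (2 * (p * 9)) `^ p * Num.sqrt (quad_var x N) `^ p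
      + \sum_(k < N) G k x * (x k.+1 - x k).
Proof.
move=> p1; apply: (pathwise_garsia (B := fun n x => Num.sqrt (quad_var x n))
  (A := fun n x => running_max x n) (g := restarted_hedge 2) p1) => //.
- by move=> k x y xy; rewrite (running_max_eq xy).
- exact: restarted_hedge_nonanticipating.
- by move=> n k x kn; rewrite /restarted_hedge kn.
- by move=> x x0 /=; rewrite x0 normr0.
- by move=> n x; rewrite /= le_max lexx.
move=> x n N x0 nN; rewrite -(subnKC nN) sum_restarted_hedge; set M := (N - n)%N.
have r0 : restart n x 0 = 0 by rewrite /restart addn0 subrr.
have h1 := running_max_le_sqrt M r0.
have h2 : running_max x (n + M) <= running_max x n + running_max (restart n x) M.
  apply: running_max_le => i iM; case: (leqP i n) => [le|/ltnW lt].
    by rewrite (le_trans (norm_le_running_max x le)) // lerDl running_max_ge0.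
  have -> : x i = x n + restart n x (i - n) by rewrite /restart subnKC // addrC subrK.
  rewrite (le_trans (ler_normD _ _)) // lerD // norm_le_running_max //.
  by rewrite leq_subLR.
have h3 : Num.sqrt (quad_var (restart n x) M) <= Num.sqrt (quad_var x (n + M)).
  by rewrite ler_wsqrtr // quad_varD lerDr quad_var_ge0.
lra.
Qed.

(** * Dyadic step functions *)

Definition dyadic_interval (R : realType) (n : nat) (k : int) : set R :=
  [set` `[k%:~R / 2 ^+ n, (k + 1)%:~R / 2 ^+ n[ ].

(** The floor is the index of the level-[n] interval containing the point, so measurability with
    respect to F_n becomes a pointwise condition. *)
Definition dyadic_step {R : realType} (n : nat) (h : R -> R) : Prop :=
  forall x y, Num.floor (x * 2 ^+ n) = Num.floor (y * 2 ^+ n) -> h x = h y.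

Lemma dyadic_intervalE (R : realType) n k (x : R) :
  dyadic_interval n k x <-> Num.floor (x * 2 ^+ n) = k.
Proof.
have p0 : 0 < 2 ^+ n :> R by rewrite exprn_gt0.
rewrite /dyadic_interval /= in_itv /= ler_pdivrMr // ltr_pdivlMr //.
by split => [|<-]; [rewrite -floor_eq => /eqP | exact: floor_itv].
Qed.

(** An integer [k] is below [a] exactly when the integer [k * c] is below [a * c]. This gives the
    nesting of the dyadic levels. *)
Lemma floor_natM (R : realType) (c : nat) (a b : R) : (0 < c)%N ->
  Num.floor (a * c%:R) = Num.floor (b * c%:R) -> Num.floor a = Num.floor b.
Proof.
move=> c0 ab; apply/eqP; rewrite eq_sym floor_eq.
have cp : 0 < c%:R :> R by rewrite ltr0n.
have E k : (k%:~R <= a) = (k%:~R <= b).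
  rewrite -(ler_pM2r cp) -[RHS](ler_pM2r cp).
  have -> : (k%:~R * c%:R : R) = (k * c%:Z)%:~R by rewrite intrM.
  by rewrite -!floor_ge_int ab.
by rewrite -E ltNge -E -ltNge floor_itv.
Qed.

Lemma dyadic_step_le (R : realType) m n (h : R -> R) :
  (m <= n)%N -> dyadic_step m h -> dyadic_step n h.
Proof.
move=> mn hm x y xy; apply: hm; apply: (@floor_natM _ (2 ^ (n - m))).
  by rewrite expn_gt0.
by rewrite natrX -!mulrA -!exprD subnKC.
Qed.

(** The sets that do not separate [x] from [y] form a sigma-algebra containing the generators. *)
Lemma dyadic_sigma_saturated (R : realType) n (A : set R) x y :
  @dyadic_sigma R n A -> Num.floor (x * 2 ^+ n) = Num.floor (y * 2 ^+ n) ->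
  A x -> A y.
Proof.
move=> mA xy.
suff : (A x <-> A y) by case.
move: A mA; apply: smallest_sub => [|A [k ->]]; last first.
  by rewrite -!/(dyadic_interval n k _) /= -!/(dyadic_interval n k _) !dyadic_intervalE xy.
split => // [A hA|F hF].
  by rewrite setTD; split => hx hy; apply: hx; apply/hA.
by split => -[i _ Fi]; exists i => //; apply/hF.
Qed.

Lemma measurable_dyadic_step (R : realType) n (h : R -> R) :
  measurable_fun [set: dyadicType R n] (h : dyadicType R n -> R) -> dyadic_step n h.
Proof.
move=> mh x y xy.
have := mh measurableT [set h x] (measurable_set1 _); rewrite setTI => mx.
by apply/esym; exact: (dyadic_sigma_saturated mx xy erefl).
Qed.

Lemma measurable_dyadic_interval (R : realType) n k :
  @dyadic_sigma R n (dyadic_interval n k).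
Proof. by apply: sub_sigma_algebra; exists k. Qed.

Lemma dyadic_sigma_lim (R : realType) n (A : set R) :
  @dyadic_sigma R n A -> measurable (A : set (dyadicLimType R)).
Proof. by move=> mA; apply: sub_sigma_algebra; exists n. Qed.

(** Every preimage is a union of countably many dyadic intervals, selected by the value of [h] at
    their left endpoints. *)
Lemma dyadic_step_measurable (R : realType) n (h : R -> R) (D : set R) :
  dyadic_step n h ->
  measurable_fun (D : set (dyadicLimType R)) (h : dyadicLimType R -> R).
Proof.
move=> hh; apply: (@measurable_funS _ _ (dyadicLimType R) _ setT) => // _ B _.
rewrite setTI.
pose I (k : int) : set (dyadicLimType R) :=
  if `[< B (h (k%:~R / 2 ^+ n)) >] then dyadic_interval n k else set0.
have p0 : 2 ^+ n != 0 :> R by rewrite expf_neq0 ?pnatr_eq0.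
have -> : h @^-1` B = \bigcup_k I k.
  have hk x : h ((Num.floor (x * 2 ^+ n))%:~R / 2 ^+ n) = h x.
    by apply: hh; rewrite divfK // intrKfloor.
  apply/seteqP; split => [x Bx|x [k _]].
    exists (Num.floor (x * 2 ^+ n)) => //; rewrite /I hk asboolT //.
    exact/dyadic_intervalE.
  rewrite /I; case: asboolP => // Bk /dyadic_intervalE xk.
  by rewrite /preimage /= -hk xk.
apply: countable_bigcupT_measurable => // k; rewrite /I; case: ifP => // _.
exact: (@dyadic_sigma_lim R n _ (@measurable_dyadic_interval R n k)).
Qed.

Lemma unit_interval_dyadic0 (R : realType) j :
  @unit_interval R j = dyadic_interval 0 j.
Proof. by rewrite /unit_interval /dyadic_interval expr0 !divr1. Qed.

Lemma measurable_unit_interval (R : realType) j :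
  measurable (@unit_interval R j : set (dyadicLimType R)).
Proof.
rewrite unit_interval_dyadic0.
exact: dyadic_sigma_lim (@measurable_dyadic_interval R _ _).
Qed.

(** Indices are counted from the left end of [j, j+1), which consists of the atoms with
    [i < 2 ^ n]. *)
Definition atom (R : realType) (j : int) (n : nat) (i : nat) : set R :=
  dyadic_interval n (j * (2 ^ n)%N + i).

Lemma measurable_atom (R : realType) j n i :
  measurable (atom j n i : set (dyadicLimType R)).
Proof. exact: dyadic_sigma_lim (@measurable_dyadic_interval R _ _). Qed.

Lemma unit_interval_atoms (R : realType) j n :
  @unit_interval R j = \big[setU/set0]_(i <- iota 0 (2 ^ n)) atom j n i.
Proof.
rewrite -bigcup_seq; apply/seteqP.
have e (x : R) k : (k%:~R <= x) = (k * (2 ^ n)%N <= Num.floor (x * 2 ^+ n)).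
  have p0 : 0 < 2 ^+ n :> R by rewrite exprn_gt0.
  rewrite floor_ge_int intrM -(ler_pM2r p0); congr (_ * _ <= _).
  by rewrite -pmulrn natrX.
have mem (x : R) : @unit_interval R j x <->
    j * (2 ^ n)%N <= Num.floor (x * 2 ^+ n) < (j + 1) * (2 ^ n)%N.
  by rewrite /unit_interval /= in_itv /= ltNge !e -ltNge.
split => x.
  move=> /mem /andP[h1 h2].
  pose z : int := Num.floor (x * 2 ^+ n) - j * (2 ^ n)%N.
  have z0 : 0 <= z by rewrite subr_ge0.
  exists (absz z); last first.
    by apply/dyadic_intervalE; rewrite gez0_abs // addrC subrK.
  rewrite /= mem_iota add0n /= -ltz_nat gez0_abs // /z.
  by rewrite ltrBlDl -[X in _ < _ + X]mul1r -mulrDl.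
move=> [i /=]; rewrite mem_iota add0n /= => hi /dyadic_intervalE e1.
by apply/mem; rewrite e1 lerDl mulrDl mul1r ltrD2l ltz_nat hi.
Qed.

Lemma trivIset_atom (R : realType) j n : trivIset setT (@atom R j n).
Proof.
move=> a b _ _ [x [/dyadic_intervalE + /dyadic_intervalE]] => -> /addrI; by case.
Qed.

(** * Integrals over unit intervals as finite sums *)

Section integral_atoms.
Context (R : realType) (P : probability (dyadicLimType R) R).
Local Open Scope ereal_scope.

Lemma integral_unit_interval j n (g : R -> R) :
  measurable_fun (@unit_interval R j : set (dyadicLimType R)) (g : dyadicLimType R -> R) ->
  \int[P]_(x in @unit_interval R j) (g x)%:E =
  \sum_(i < 2 ^ n) \int[P]_(x in atom j n i) (g x)%:E.
Proof.
rewrite (unit_interval_atoms _ _ n) => mg.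
rewrite (@integral_bigsetU_EFin _ (dyadicLimType R)) ?iota_uniq //.
- by rewrite -[X in iota _ X]subn0 big_mkord.
- by move=> i; exact: measurable_atom.
- exact: sub_trivIset (@trivIset_atom R j n).
- exact/measurable_EFinP.
Qed.

Definition left_point (j : int) n (i : nat) : R := ((j * (2 ^ n)%N + i)%:~R / 2 ^+ n)%R.

Lemma dyadic_step_atom j n i (g : R -> R) x : dyadic_step n g ->
  atom j n i x -> g x = g (left_point j n i).
Proof.
move=> gn /dyadic_intervalE xi; apply: gn.
by rewrite /left_point divfK ?expf_neq0 ?pnatr_eq0 // intrKfloor.
Qed.

(** A real-valued form of the integral, whose linearity and monotonicity are plain facts about
    finite sums. *)
Definition step_mean (j : int) n (g : R -> R) : R :=
  (\sum_(i < 2 ^ n) fine (P (atom j n i)) * g (left_point j n i))%R.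

Lemma integral_dyadic_step j n (g : R -> R) : dyadic_step n g ->
  \int[P]_(x in @unit_interval R j) (g x)%:E = (step_mean j n g)%:E.
Proof.
move=> gn; rewrite (@integral_unit_interval _ n); last first.
  exact: dyadic_step_measurable gn.
rewrite /step_mean -sumEFin; apply: eq_bigr => i _.
rewrite (eq_integral (cst (g (left_point j n i))%:E)) => [|x /set_mem xi]; last first.
  by rewrite (dyadic_step_atom gn xi).
rewrite integral_cst; last exact: measurable_atom.
have Pfin : P (atom j n i) \is a fin_num.
  exact: (@fin_num_measure _ _ _ P _ (@measurable_atom R j n i)).
by rewrite EFinM (fineK Pfin) muleC.
Qed.

(** On each level-[n] atom [h] is a constant and factors out, and the martingale property on that
    atom makes the integral of the increment vanish. *)
Lemma step_mean_transform (f : nat -> R -> R) j n N (h : R -> R) :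
  dyadic_martingale P f -> (n < N)%N -> dyadic_step n h ->
  step_mean j N (fun x => (h x * (f n.+1 x - f n x))%R) = 0%R.
Proof.
move=> [f0 mf intf martf] nN hn.
have fstep k : dyadic_step k (f k) by exact: measurable_dyadic_step.
have dstep : dyadic_step n.+1 (fun x => (h x * (f n.+1 x - f n x))%R).
  move=> x y xy; rewrite (fstep n.+1 x y) //.
  by rewrite (dyadic_step_le (leqnSn n) (fstep n) xy) (dyadic_step_le (leqnSn n) hn xy).
apply: EFin_inj; rewrite -integral_dyadic_step; last exact: dyadic_step_le dstep.
rewrite (@integral_unit_interval _ n); last first.
  exact: dyadic_step_measurable dstep.
apply: big1 => i _.
have mA := @measurable_atom R j n i.
have sA (k : nat) : P.-integrable (atom j n i) (EFin \o f k).
  exact: integrableS (intf k).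
rewrite (eq_integral (fun x : dyadicLimType R => (h (left_point j n i))%:E * ((f n.+1 x)%:E - (f n x)%:E))); last first.
  by move=> x /set_mem xi; rewrite (dyadic_step_atom hn xi) EFinM EFinB.
rewrite integralZl //; last exact: (integrableB mA (sA _) (sA _)).
rewrite (integralB_EFin mA (sA _) (sA _)).
have [_ _ ->] := martf n.+1 n (leqnSn n); last exact: (@measurable_dyadic_interval R n _).
rewrite subee ?mule0 //; exact: (integrable_fin_num mA (sA _)).
Qed.

End integral_atoms.

(** * Amalgam norms *)

Section martingale_paths.
Context (R : realType) (P : probability (dyadicLimType R) R).

Lemma dyadic_step_path (f : nat -> R -> R) (phi : nat -> (nat -> R) -> R) n :
  dyadic_martingale P f -> nonanticipating phi ->
  dyadic_step n (fun x => phi n (f ^~ x)).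
Proof.
move=> [_ mf _ _] phin x y xy; apply: phin => i le.
exact: (dyadic_step_le le (measurable_dyadic_step (mf i)) xy).
Qed.

(** Adding the vanishing means of the transform to the right side reduces the claim to the pathwise
    inequality at one point of each level-[N] atom, weighted by its probability. *)
Lemma integral_path_le (f : nat -> R -> R) (phi psi G : nat -> (nat -> R) -> R) K j N :
  dyadic_martingale P f -> nonanticipating phi -> nonanticipating psi ->
  nonanticipating G ->
  (forall x, x 0 = 0 -> phi N x <= K * psi N x + \sum_(k < N) G k x * (x k.+1 - x k)) ->
  (\int[P]_(x in @unit_interval R j) (phi N (f ^~ x))%:E <=
   K%:E * \int[P]_(x in @unit_interval R j) (psi N (f ^~ x))%:E)%E.
Proof.
move=> mf nphi npsi nG H; have f0 : forall x, f 0 x = 0 by case: mf.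
rewrite !(@integral_dyadic_step _ P j N); [|exact: dyadic_step_path..].
rewrite -EFinM lee_fin.
have -> : K * step_mean P j N (fun x => psi N (f ^~ x)) =
  K * step_mean P j N (fun x => psi N (f ^~ x)) +
  \sum_(k < N) step_mean P j N (fun x => G k (f ^~ x) * (f k.+1 x - f k x)).
  rewrite [X in _ + X]big1 ?addr0 // => k _.
  exact: step_mean_transform mf (ltn_ord k) (dyadic_step_path mf nG).
rewrite /step_mean exchange_big /= mulr_sumr -big_split /=.
apply: ler_sum => i _; rewrite -mulr_sumr mulrCA -mulrDr.
by apply: ler_wpM2l; [rewrite fine_ge0 | exact: H].
Qed.

End martingale_paths.

(** * Suprema, powers and monotone convergence *)

Section sup_power.
Local Open Scope ereal_scope.

Lemma nondecreasing_cvg_ereal_sup {R : realType} (u : nat -> \bar R) :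
  nondecreasing_seq u -> limn u = ereal_sup (range u).
Proof. by move=> nd; apply/cvg_lim => //; exact: ereal_nondecreasing_cvgn. Qed.

(** Monotonicity of the power gives one inequality, and monotonicity of the inverse power [r^-1] the
    other. *)
Lemma poweR_ereal_sup {R : realType} (u : nat -> \bar R) (r : R) : (0 < r)%R ->
  (forall n, 0 <= u n) ->
  ereal_sup (range u) `^ r = ereal_sup (range (fun n => u n `^ r)).
Proof.
move=> r0 u0.
have in0 (x : \bar R) : 0 <= x -> x \in `[0, +oo].
  by move=> x0; rewrite in_itv /= x0 leey.
have s0 : 0 <= ereal_sup (range u).
  by apply: le_trans (u0 0%N) _; apply: ereal_sup_ubound; exists 0%N.
have t0 : 0 <= ereal_sup (range (fun n => u n `^ r)).
  by apply: le_trans (poweR_ge0 (u 0%N) r) _; apply: ereal_sup_ubound; exists 0%N.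
have ri0 : (0 <= r^-1)%R by rewrite invr_ge0 ltW.
have rn0 : r != 0%R by rewrite gt_eqF.
apply/eqP; rewrite eq_le; apply/andP; split; last first.
  apply: ge_ereal_sup => _ [n _ <-]; apply: gt0_ler_poweR; rewrite ?in0 ?(ltW r0) //.
  by apply: ereal_sup_ubound; exists n.
have <- : (ereal_sup (range (fun n => u n `^ r)) `^ r^-1) `^ r =
    ereal_sup (range (fun n => u n `^ r)).
  by rewrite -poweRrM mulVf // poweRe1.
apply: gt0_ler_poweR; rewrite ?in0 ?poweR_ge0 ?(ltW r0) //.
apply: ge_ereal_sup => _ [n _ <-].
have <- : (u n `^ r) `^ r^-1 = u n by rewrite -poweRrM mulfV // poweRe1.
apply: gt0_ler_poweR; rewrite ?in0 ?poweR_ge0 //.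
by apply: ereal_sup_ubound; exists n.
Qed.

Lemma integral_ereal_sup_le d (T : measurableType d) (R : realType)
    (mu : {measure set T -> \bar R}) (D : set T) (u v : nat -> T -> \bar R) (K : R) :
  measurable D -> (0 <= K)%R ->
  (forall n, measurable_fun D (u n)) -> (forall n, measurable_fun D (v n)) ->
  (forall n x, 0 <= u n x) -> (forall n x, 0 <= v n x) ->
  (forall x, nondecreasing_seq (u ^~ x)) -> (forall x, nondecreasing_seq (v ^~ x)) ->
  (forall n, \int[mu]_(x in D) u n x <= K%:E * \int[mu]_(x in D) v n x) ->
  \int[mu]_(x in D) ereal_sup (range (u ^~ x)) <=
  K%:E * \int[mu]_(x in D) ereal_sup (range (v ^~ x)).
Proof.
move=> mD K0 mu_ mv u0 v0 ndu ndv uv.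
under eq_integral do rewrite -nondecreasing_cvg_ereal_sup //.
under [X in _ * X]eq_integral do rewrite -nondecreasing_cvg_ereal_sup //.
have ndI (w : nat -> T -> \bar R) : (forall n, measurable_fun D (w n)) ->
    (forall n x, 0 <= w n x) -> (forall x, nondecreasing_seq (w ^~ x)) ->
    nondecreasing_seq (fun n => \int[mu]_(x in D) w n x).
  by move=> mw w0 ndw m n mn; apply: ge0_le_integral => // x _; exact: ndw.
rewrite !monotone_convergence //; try by move=> x _; auto.
rewrite !nondecreasing_cvg_ereal_sup; [|exact: ndI..].
apply: ge_ereal_sup => _ [n _ <-]; apply: le_trans (uv n) _.
by rewrite lee_wpmul2l ?lee_fin //; apply: ereal_sup_ubound; exists n.
Qed.

End sup_power.

Lemma maximal_function_sup (R : realType) (f : nat -> R -> R) x :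
  maximal_function f x = ereal_sup (range (fun n => (running_max (f ^~ x) n)%:E)).
Proof.
apply/eqP; rewrite eq_le; apply/andP; split; apply: ge_ereal_sup => _ [n _ <-].
  apply: (@le_trans _ _ (running_max (f ^~ x) n)%:E).
    by rewrite lee_fin (norm_le_running_max (f ^~ x)).
  by apply: ereal_sup_ubound; exists n.
have [i <-] : exists i, `|f i x| = running_max (f ^~ x) n.
  elim: n => [|n [i IH]] /=; first by exists 0%N.
  by rewrite /Num.max; case: ifP => _; [exists n.+1 | exists i].
by apply: ereal_sup_ubound; exists i.
Qed.

Lemma square_function_sup (R : realType) (f : nat -> R -> R) x :
  square_function f x =
  ereal_sup (range (fun n => (Num.sqrt (quad_var (f ^~ x) n))%:E)).
Proof.
have q0 n := quad_var_ge0 (f ^~ x) n.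
rewrite /square_function.
have -> : (\sum_(0 <= n <oo) (`|mart_diff f n x| ^+ 2)%:E)%E =
   ereal_sup (range (fun n => (quad_var (f ^~ x) n)%:E)).
  rewrite -(nondecreasing_cvg_ereal_sup (u := fun n => (quad_var (f ^~ x) n)%:E)); last first.
    by apply/nondecreasing_seqP => n; rewrite lee_fin quad_varS lerDl sqr_ge0.
  (* The zeroth martingale difference is 0, so [quad_var] at [n] is the partial sum of [n.+1] terms;
     the shift does not change the limit. *)
  have -> : (fun n => (quad_var (f ^~ x) n)%:E) =
      (fun n => (\sum_(0 <= k < n.+1) (`|mart_diff f k x| ^+ 2)%:E)%E).
    apply/funext => n; rewrite sumEFin big_nat_recl // normr0 expr0n add0r big_mkord.
    by congr EFin; apply: eq_bigr => k _; rewrite real_normK ?num_real.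
  apply/esym; apply/cvg_lim => //.
  rewrite (@cvg_shiftS _ (fun n => (\sum_(0 <= k < n) (`|mart_diff f k x| ^+ 2)%:E)%E)).
  apply: (@is_cvg_nneseries _ (fun k => (`|mart_diff f k x| ^+ 2)%:E) xpredT 0) => k _ _.
  by rewrite lee_fin sqr_ge0.
rewrite poweR_ereal_sup ?invr_gt0 //.
by under eq_fun do rewrite poweR_EFin powR12_sqrt //.
Qed.

Lemma amalgam_norm_le (R : realType) (P : probability (dyadicLimType R) R)
    (p K : R) (q : \bar R) (g h : R -> \bar R) :
  0 < p -> 0 <= K -> (1 <= q)%E ->
  (forall j, \int[P]_(x in @unit_interval R j) (`|g x| `^ p) <=
     K%:E * \int[P]_(x in @unit_interval R j) (`|h x| `^ p))%E ->
  (amalgam_norm P p q g <= (K `^ p^-1)%:E * amalgam_norm P p q h)%E.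
Proof.
move=> p0 K0 q1 gh.
have in0 (x : \bar R) : (0 <= x)%E -> x \in `[0%E, +oo%E].
  by move=> x0; rewrite in_itv /= x0 leey.
have I0 (w : R -> \bar R) j :
    (0 <= \int[P]_(x in @unit_interval R j) (`|w x| `^ p))%E.
  by apply: integral_ge0 => x _; exact: poweR_ge0.
have pow j s : 0 <= s ->
    ((\int[P]_(x in @unit_interval R j) (`|g x| `^ p)) `^ s <=
     (K `^ s)%:E * (\int[P]_(x in @unit_interval R j) (`|h x| `^ p)) `^ s)%E.
  move=> s0; rewrite -poweR_EFin -poweRM ?lee_fin //.
  by apply: gt0_ler_poweR; rewrite ?in0 ?mule_ge0 ?lee_fin.
case: q q1 => [r|_|//]; last first.
  apply: ge_ereal_sup => _ [j _ <-].
  apply: le_trans (pow j _ _) _; first by rewrite invr_ge0 ltW.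
  rewrite lee_wpmul2l ?lee_fin ?powR_ge0 //.
  by apply: ereal_sup_ubound; exists j.
rewrite lee_fin => r1; have r0 : 0 < r by lra.
(* The exponents [r / p] and [r^-1] multiply to [p^-1], which frees the constant from [q]. *)
have -> : (K `^ p^-1)%:E = ((K `^ (r / p))%:E `^ r^-1)%E.
  by rewrite poweR_EFin -powRrM mulrC mulrA mulVf ?mul1r // gt_eqF.
rewrite /amalgam_norm -poweRM ?lee_fin ?powR_ge0 //; last first.
  by apply: esum_ge0 => j _; exact: poweR_ge0.
have rp0 : 0 <= r / p by rewrite divr_ge0 // ltW.
apply: gt0_ler_poweR; rewrite ?in0 ?invr_ge0 ?(ltW r0) //.
- by apply: esum_ge0 => j _; exact: poweR_ge0.
- rewrite mule_ge0 ?lee_fin ?powR_ge0 //.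
  by apply: esum_ge0 => j _; exact: poweR_ge0.
(* The sum over all integers is the supremum of its finite subsums, so it suffices to bound each of
   these. *)
apply: ge_ereal_sup => _ [A Afs <-].
apply: (@le_trans _ _ (\sum_(j \in A) ((K `^ (r / p))%:E *
    (\int[P]_(x in @unit_interval R j) (`|h x| `^ p)) `^ (r / p)))%E).
  by apply: lee_fsum; [case: Afs | move=> j _; exact: pow].
rewrite -ge0_mule_fsumr; last by move=> j; exact: poweR_ge0.
rewrite lee_wpmul2l ?lee_fin ?powR_ge0 //.
by apply: ereal_sup_ubound; exists A.
Qed.

(** The pathwise inequality is integrated at each finite time, and monotone convergence passes to
    the suprema on every unit interval. The constant enters as a p-th power so that the norm
    inequality has constant [c]. *)
Lemma amalgam_norm_sup_le (R : realType) (P : probability (dyadicLimType R) R)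
    (f : nat -> R -> R) (phi psi G : nat -> (nat -> R) -> R) (p c : R) (q : \bar R) :
  1 <= p -> 0 <= c -> (1 <= q)%E -> dyadic_martingale P f ->
  nonanticipating phi -> nonanticipating psi -> nonanticipating G ->
  (forall n x, 0 <= phi n x <= phi n.+1 x) -> (forall n x, 0 <= psi n x <= psi n.+1 x) ->
  (forall x N, x 0 = 0 -> phi N x `^ p <=
     c `^ p * psi N x `^ p + \sum_(k < N) G k x * (x k.+1 - x k)) ->
  (amalgam_norm P p q (fun x => ereal_sup (range (fun n => (phi n (f ^~ x))%:E))) <=
  c%:E * amalgam_norm P p q (fun x => ereal_sup (range (fun n => (psi n (f ^~ x))%:E))))%E.
Proof.
move=> p1 c0 q1 mf nphi npsi nG hphi hpsi H; have p0 : 0 < p by lra.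
have -> : c = (c `^ p) `^ p^-1 by rewrite -powRrM mulfV ?gt_eqF // powRr1.
apply: amalgam_norm_le; rewrite ?powR_ge0 // => j.
have E (w : nat -> (nat -> R) -> R) x : (forall n x, 0 <= w n x <= w n.+1 x) ->
    (`|ereal_sup (range (fun n => (w n (f ^~ x))%:E))| `^ p)%E =
    ereal_sup (range (fun n => (w n (f ^~ x) `^ p)%:E)).
  move=> hw; have w0 n y : 0 <= w n y by case/andP: (hw n y).
  rewrite gee0_abs.
    by rewrite poweR_ereal_sup // => n; rewrite lee_fin.
  apply: le_trans (_ : (w 0 (f ^~ x))%:E <= _)%E; first by rewrite lee_fin.
  by apply: ereal_sup_ubound; exists 0%N.
under eq_integral do rewrite E //.
under [X in (_ <= _ * X)%E]eq_integral do rewrite E //.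
have nP w : nonanticipating w -> nonanticipating (fun n x => w n x `^ p).
  by move=> nw k x y xy; rewrite (nw k x y xy).
have nd w x : (forall n x, 0 <= w n x <= w n.+1 x) ->
   nondecreasing_seq (fun n => (w n (f ^~ x) `^ p)%:E : \bar R).
  move=> hw; apply/nondecreasing_seqP => n; rewrite lee_fin.
  have /andP[w0 w1] := hw n (f ^~ x).
  by apply: ge0_ler_powR; rewrite ?nnegrE //; [exact: ltW | exact: le_trans w1].
apply: (@integral_ereal_sup_le _ (dyadicLimType R) _ _ _
  (fun n x => (phi n (f ^~ x) `^ p)%:E) (fun n x => (psi n (f ^~ x) `^ p)%:E)).
- exact: measurable_unit_interval.
- exact: powR_ge0.
- move=> n; apply/measurable_EFinP.
  apply: (dyadic_step_measurable (n := n)).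
  exact: (dyadic_step_path (phi := fun n x => phi n x `^ p) mf (nP _ nphi)).
- move=> n; apply/measurable_EFinP.
  apply: (dyadic_step_measurable (n := n)).
  exact: (dyadic_step_path (phi := fun n x => psi n x `^ p) mf (nP _ npsi)).
- by move=> n x; rewrite lee_fin powR_ge0.
- by move=> n x; rewrite lee_fin powR_ge0.
- by move=> x; exact: nd.
- by move=> x; exact: nd.
move=> n; apply: (integral_path_le (phi := fun n x => phi n x `^ p)
  (psi := fun n x => psi n x `^ p) _ mf (nP _ nphi) (nP _ npsi) nG).
by move=> x; exact: H.
Qed.

Lemma amalgam_norm_square_max (R : realType) (P : probability (dyadicLimType R) R)
    (f : nat -> R -> R) (p : R) (q : \bar R) :
  1 <= p -> (1 <= q)%E -> dyadic_martingale P f ->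
  (HS_norm P p q f <= (2 * (p * 14))%:E * Hstar_norm P p q f)%E /\
  (Hstar_norm P p q f <= (2 * (p * 9))%:E * HS_norm P p q f)%E.
Proof.
move=> p1 q1 mf; rewrite /HS_norm /Hstar_norm.
have -> : square_function f = _ := funext (square_function_sup f).
have -> : maximal_function f = _ := funext (maximal_function_sup f).
pose S n (x : nat -> R) := Num.sqrt (quad_var x n).
pose M n (x : nat -> R) := running_max x n.
have nS : nonanticipating S by move=> k x y xy; rewrite /S (quad_var_eq xy).
have nM : nonanticipating M by move=> k x y xy; rewrite /M (running_max_eq xy).
have hS n x : 0 <= S n x <= S n.+1 x.
  by rewrite sqrtr_ge0 ler_wsqrtr // quad_varS lerDl sqr_ge0.
have hM n x : 0 <= M n x <= M n.+1 x.
  by rewrite running_max_ge0 /M /= le_max lexx.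
have [G nG hG] := pathwise_square_le_max p1.
have [G' nG' hG'] := pathwise_max_le_square p1.
split.
  by apply: (amalgam_norm_sup_le (phi := S) (psi := M)) nG _ _ _ => //; lra.
by apply: (amalgam_norm_sup_le (phi := M) (psi := S)) nG' _ _ _ => //; lra.
Qed.

Theorem theorem3p3 (R : realType) (p : R) (hp : 1 <= p) :
  (forall (P : probability (dyadicLimType R) R) (q : \bar R),
     (1%:E <= q)%E -> HS_space P p q = Hstar_space P p q) /\
  exists c C : R, 0 < c /\ 0 < C /\
    forall (P : probability (dyadicLimType R) R) (f : nat -> R -> R),
      dyadic_martingale P f ->
      forall q : \bar R, (1%:E <= q)%E ->
        (c%:E * HS_norm P p q f <= Hstar_norm P p q f)%E /\
        (Hstar_norm P p q f <= C%:E * HS_norm P p q f)%E.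
Proof.
split.
  move=> P q q1; apply/seteqP; split => f [mf fin]; split=> //.
    apply: le_lt_trans (amalgam_norm_square_max hp q1 mf).2 _.
    by rewrite lte_mul_pinfty // lee_fin; lra.
  apply: le_lt_trans (amalgam_norm_square_max hp q1 mf).1 _.
  by rewrite lte_mul_pinfty // lee_fin; lra.
have c0 : 0 < 2 * (p * 14) by lra.
exists (2 * (p * 14))^-1, (2 * (p * 9)); split; first by rewrite invr_gt0.
split; first by lra.
move=> P f mf q q1; have [h1 h2] := amalgam_norm_square_max hp q1 mf.
by split => //; rewrite lee_pdivrMl.
Qed.
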